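(* Let $p_1$ be a probability density with respect to $\mu$ and let $p_0$ be a non-negative function on $X$ such that $p_1$ is absolutely continuous with respect to $p_0$. Let $q>0$ be such that $M_q(p_1,p_0)=\int p_1(x)^q p_0(x)^{1-q}\,\mathrm{d}\mu(x)<\infty$, let $$p_q(x)=\frac{p_1(x)^q p_0(x)^{1-q}}{M_q(p_1,p_0)},$$ and assume that $E_q\left[\log\frac{p_1}{p_0}\right]$ is finite and that $D(p_q\|p_0)=\eta$. Then the minimum of $D(p\|p_1)$ over probability densities $p$ satisfying $D(p\|p_0)=\eta$, which is attained at $p_q$, is given by $$D(p_q\|p_1)=\left(1-\frac1q\right)\left(\eta-D_q(p_1\|p_0)\right),$$ where $D_q(p_1\|p_0)$ is the Rényi information divergence with index $q$ from $p_1$ to $p_0$.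
   Context: $\mu$ is a general measure on a set $X$; all densities are densities with respect to $\mu$. $D(f\|g)=\int f\log\frac{f}{g}\,\mathrm{d}\mu$ is the Kullback-Leibler divergence, with the conventions $0\log 0=0\log(0/a)=0\log(0/0)=0$ (and value $+\infty$ when $f$ is positive on a set of positive $\mu$-measure where $g=0$). The Rényi divergence is $D_q(f\|g)=\frac{1}{q-1}\log\int f(x)^q g(x)^{1-q}\,\mathrm{d}\mu(x)$ for $q\ne1$, and $D_1(f\|g)=D(f\|g)$ (its limit as $q\to1$). ''$p_1$ absolutely continuous with respect to $p_0$'' means $p_1=0$ $\mu$-almost everywhere where $p_0=0$. The product $p_1^qp_0^{1-q}$ is taken to be $0$ where $p_0=p_1=0$. $E_q[h]=\int h(x)p_q(x)\,\mathrm{d}\mu(x)$. *)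

(* Defs.v *)
From HB Require Import structures.
From mathcomp Require Import all_boot all_order all_algebra.
From mathcomp Require Import all_classical all_reals all_analysis.

Set Implicit Arguments.
Unset Strict Implicit.
Unset Printing Implicit Defensive.

Import Order.TTheory GRing.Theory Num.Theory.
Import numFieldNormedType.Exports.

Local Open Scope classical_set_scope.
Local Open Scope ring_scope.
Local Open Scope ereal_scope.

Section divergences.
Context (d : measure_display) (X : measurableType d) (R : realType).
Variable mu : {measure set X -> \bar R}.
Implicit Types (f g p h : X -> R) (q : R).

Definition nonneg_density f : Prop :=
  measurable_fun [set: X] f /\ (forall x, (0 <= f x)%R).

Definition prob_density p : Prop :=
  nonneg_density p /\ \int[mu]_x (p x)%:E = 1.

Definition abs_cont f g : Prop := {ae mu, forall x, g x = 0%R -> f x = 0%R}.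

Definition singular_part f g : set X := [set x | (0 < f x)%R /\ g x = 0%R].

(* In the second branch the integrand is f log (f / g) wherever f and g are
   both positive, and 0 where f = 0, whatever the totalized values of / and ln
   at 0; the remaining points, where f > 0 = g, are then mu-null. When the
   positive and negative parts of the integral are both infinite, the library
   value of the integral is -oo; so the divergence is a real number exactly
   when the integral converges absolutely. *)
Definition KL f g : \bar R :=
  if 0 < mu (singular_part f g) then +oo
  else \int[mu]_x (f x * ln (f x / g x))%:E.

(* For q > 0 this vanishes where f = 0, in particular where f = g = 0. *)
Definition tilt q f g (x : X) : R := (f x `^ q * g x `^ (1 - q))%R.

(* For q > 1, f ^ q * g ^ (1 - q) is infinite where f > 0 = g, whereas the
   real-valued [tilt] is 0 there; the first branch restores the value of the
   integral. *)
Definition Mq q f g : \bar R :=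
  if (1 < q)%R && (0 < mu (singular_part f g)) then +oo
  else \int[mu]_x (tilt q f g x)%:E.

Definition escort q f g (x : X) : R := (tilt q f g x / fine (Mq q f g))%R.

Definition escort_mean q f g h : \bar R :=
  \int[mu]_x (h x * escort q f g x)%:E.

(* [ln] is totalized, but its arbitrary values do not contribute to
   [escort_mean q f g (log_ratio f g)] when q > 0 and f << g, since the escort
   density is then almost everywhere 0 where f = 0 or g = 0. *)
Definition log_ratio f g (x : X) : R := ln (f x / g x).

Definition renyi q f g : \bar R :=
  if q == 1%R then KL f g else ((q - 1)^-1)%:E * lne (Mq q f g).

End divergences.

(* Main.v *)
(* Where p, p0, p1 are positive, ln pq = q ln p1 + (1 - q) ln p0 - ln M_q gives
     p ln (p / p1) = (1 - 1/q) p ln (p / p0) - (ln M_q / q) p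
                     + (1/q) p ln (p / pq).
   Under the constraint D(p || p0) = eta the first two terms integrate to the
   announced minimum, whatever p is; the last one vanishes for p = pq and is at
   least (p - pq) / q, which integrates to 0. Using this integrable pointwise
   minorant avoids any discussion of the convergence of D(p || p1). *)
Require Import Defs.
From mathcomp Require Import all_boot all_order all_algebra.
From mathcomp Require Import all_classical all_reals all_analysis.
From mathcomp Require Import measurable_realfun ring lra.

Import Order.TTheory GRing.Theory Num.Theory.
Import numFieldNormedType.Exports.

Local Open Scope classical_set_scope.
Local Open Scope ring_scope.
Local Open Scope ereal_scope.

(** * Pointwise logarithmic bound and decomposition *)

Lemma le_mul_ln_div (R : realType) (a b : R) :
  (0 < a)%R -> (0 < b)%R -> (a - b <= a * ln (a / b))%R.
Proof.
move=> a0 b0.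
(* The tangent bound [ln (1 + t) <= t] at [t = b / a - 1], to be multiplied by [a]. *)
have h : (ln (b / a) <= b / a - 1)%R.
  have := @le_ln1Dx R (b / a - 1)%R; rewrite subrKC; apply.
  by rewrite ltrBrDr addNr divr_gt0.
have {}h : (a * ln (b / a) <= b - a)%R.
  apply: le_trans (ler_wpM2l (ltW a0) h) _.
  by rewrite mulrBr mulr1 mulrCA divff ?gt_eqF// mulr1.
rewrite ln_div ?posrE// in h; rewrite ln_div ?posrE//; lra.
Qed.

(** Positivity allows every logarithm to be expanded, which leaves a field identity in [ln a],
    [ln b], [ln c], [ln m]. The roles are [a = p x], [b = p1 x], [c = p0 x], [m] the normalizing
    constant. *)
Lemma mul_ln_div_tilt (R : realType) (q m a b c : R) :
  (0 < q)%R -> (0 < m)%R -> (0 < a)%R -> (0 < b)%R -> (0 < c)%R ->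
  (a * ln (a / b) = (1 - q^-1) * (a * ln (a / c)) - ln m / q * a +
     q^-1 * (a * ln (a / (b `^ q * c `^ (1 - q) / m))))%R.
Proof.
move=> q0 m0 a0 b0 c0.
have bq := @powR_gt0 R b q b0; have cq := @powR_gt0 R c (1 - q)%R c0.
rewrite !(ln_div, lnM) ?posrE ?divr_gt0 ?mulr_gt0// !ln_powR.
by field; rewrite gt_eqF.
Qed.

(** * Measurability, absolute continuity, comparison of integrals *)

Lemma measurable_div_nonneg (d : measure_display) (X : measurableType d)
    (R : realType) (f g : X -> R) :
  measurable_fun [set: X] f -> nonneg_density g ->
  measurable_fun [set: X] (fun x => f x / g x)%R.
Proof.
move=> mf [mg g0]; apply: measurable_funM => //.
(* For [g x >= 0] the inverse is a real power, also at 0, where both are 0. *)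
rewrite (_ : (fun x => _) = (fun x => g x `^ (-1))%R); last first.
  by apply/funext => x; rewrite powR_inv1.
by apply: (measurableT_comp (@measurable_powR R _)).
Qed.

Lemma measurable_KL_integrand (d : measure_display) (X : measurableType d)
    (R : realType) (f g : X -> R) :
  nonneg_density f -> nonneg_density g ->
  measurable_fun [set: X] (fun x => f x * ln (f x / g x))%R.
Proof.
move=> nf ng; have [mf _] := nf; apply: measurable_funM => //.
apply: (measurableT_comp (@measurable_ln R)).
exact: measurable_div_nonneg.
Qed.

(** As [f >= 0], [singular_part f g] is exactly the exceptional set of [abs_cont]; being measurable,
    it is negligible iff null. This decides the branches of [KL] and [Mq]. *)
Lemma abs_contP (d : measure_display) (X : measurableType d) (R : realType)
    (mu : {measure set X -> \bar R}) (f g : X -> R) :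
  nonneg_density f -> nonneg_density g ->
  abs_cont mu f g <-> mu (singular_part f g) = 0.
Proof.
move=> [mf f0] [mg g0].
have mS : measurable (singular_part f g).
  rewrite (_ : singular_part f g =
    (fun x => 0 < f x)%R @^-1` [set true] `&`
    (fun x => g x == 0)%R @^-1` [set true]); last first.
    apply/seteqP; split => x /= []; first by move=> ? ->; split; rewrite ?eqxx.
    by move=> ? /eqP.
  apply: measurableI; rewrite -[X in measurable X]setTI.
    by apply: (measurable_fun_ltr (@measurable_cst _ _ _ _ _ _) mf).
  by apply: (measurable_fun_eqr mg (@measurable_cst _ _ _ _ _ _)).
rewrite -(propext (negligibleP mu mS)) /abs_cont; split; apply: negligibleS.
  by move=> x /= [fx gx] /(_ gx) fx0; rewrite fx0 ltxx in fx.
move=> x /= /not_implyP[gx /eqP fx]; split => //.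
by rewrite lt_neqAle eq_sym fx f0.
Qed.

Lemma KL_abs_cont (d : measure_display) (X : measurableType d) (R : realType)
    (mu : {measure set X -> \bar R}) (f g : X -> R) :
  nonneg_density f -> nonneg_density g -> abs_cont mu f g ->
  KL mu f g = \int[mu]_x (f x * ln (f x / g x))%:E.
Proof. by move=> nf ng /abs_contP; rewrite /KL => ->//; rewrite ltxx. Qed.

Lemma abs_cont_KL_neqy (d : measure_display) (X : measurableType d)
    (R : realType) (mu : {measure set X -> \bar R}) (f g : X -> R) :
  nonneg_density f -> nonneg_density g -> KL mu f g != +oo -> abs_cont mu f g.
Proof.
move=> nf ng; rewrite /KL; case: ifPn; first by rewrite eqxx.
by rewrite -leNgt measure_le0 => /eqP ? _; apply/abs_contP.
Qed.

(** Positive and negative parts are compared separately, and extended subtraction is monotone even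
    at [+oo - +oo = -oo]; hence no integrability is required. *)
Lemma le_integral_ae (d : measure_display) (X : measurableType d)
    (R : realType) (mu : {measure set X -> \bar R}) (f g : X -> \bar R) :
  measurable_fun [set: X] f -> measurable_fun [set: X] g ->
  {ae mu, forall x, f x <= g x} -> \int[mu]_x f x <= \int[mu]_x g x.
Proof.
move=> mf mg fg; rewrite integralE [leRHS]integralE; apply: leeB.
  apply: ae_ge0_le_integral => //; try exact: measurable_funepos.
  apply: filterS fg => x fgx _; rewrite !funeposE.
  by rewrite ge_max le_max fgx/= le_max lexx orbT.
apply: ae_ge0_le_integral => //; try exact: measurable_funeneg.
apply: filterS fg => x fgx _; rewrite !funenegE.
by rewrite ge_max le_max leeN2 fgx/= le_max lexx orbT.
Qed.

(** * Normalizing constant, escort density and minorant *)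

Section escort_facts.
Context (d : measure_display) (X : measurableType d) (R : realType).
Context (mu : {measure set X -> \bar R}) (p1 p0 : X -> R) (q : R).
Hypotheses (hp1 : prob_density mu p1) (hp0 : nonneg_density p0).
Hypotheses (hac : abs_cont mu p1 p0) (hq : (0 < q)%R).
Hypothesis hM : Mq mu q p1 p0 < +oo.

Let m := fine (Mq mu q p1 p0).

Lemma tilt_nonneg_density : nonneg_density (tilt q p1 p0).
Proof.
have [[m1 _] _] := hp1; have [m0 _] := hp0; split => [|x]; last first.
  by rewrite mulr_ge0// powR_ge0.
by apply: measurable_funM; apply: (measurableT_comp (@measurable_powR R _)).
Qed.

Lemma Mq_integral : Mq mu q p1 p0 = \int[mu]_x (tilt q p1 p0 x)%:E.
Proof.
have [n1 _] := hp1.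
by rewrite /Mq (abs_contP _ _ _ _ _ _ n1 hp0).1// ltxx andbF.
Qed.

(** A zero integral would make [tilt] vanish almost everywhere. Its zeros have [p1 x = 0] or
    [p0 x = 0], so [p1] would vanish almost everywhere by absolute continuity, against its mass
    1. *)
Lemma Mq_gt0 : 0 < Mq mu q p1 p0.
Proof.
have [mt t0] := tilt_nonneg_density; have [[m1 p1_0] i1] := hp1.
rewrite Mq_integral lt_neqAle integral_ge0 ?andbT; last first.
  by move=> x _; rewrite lee_fin.
apply/negP => /eqP /esym it0.
have /ae_eq_integral_abs : \int[mu]_x `|(tilt q p1 p0 x)%:E| = 0.
  by under eq_integral do rewrite gee0_abs ?lee_fin//.
move=> /(_ measurableT) t_ae0.
have {t_ae0} t_ae0 := t_ae0 ltac:(exact/measurable_EFinP).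
have : \int[mu]_x (p1 x)%:E = \int[mu]_(x in [set: X]) 0.
  apply: ae_eq_integral => //; first exact/measurable_EFinP.
  apply: filterS2 t_ae0 hac => x /(_ I) [] /eqP + p01 _.
  have [->//|p1x] := eqVneq (p1 x) 0%R.
  rewrite /tilt mulf_eq0 !powR_eq0 (negbTE p1x)/= => /andP[/eqP/p01 p1x0].
  by rewrite p1x0 eqxx in p1x.
by rewrite i1 integral0 => /eqP; rewrite onee_eq0.
Qed.

Lemma Mq_fineK : Mq mu q p1 p0 = m%:E.
Proof. by rewrite fineK// ge0_fin_numE// ltW// Mq_gt0. Qed.

Lemma fine_Mq_gt0 : (0 < m)%R.
Proof. by rewrite -lte_fin -Mq_fineK Mq_gt0. Qed.

Lemma escort_prob_density : prob_density mu (escort mu q p1 p0).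
Proof.
have [mt t0] := tilt_nonneg_density; have m0 := fine_Mq_gt0.
split.
  by split => [|x]; [exact: measurable_funM | rewrite /escort divr_ge0// ltW].
under eq_integral do rewrite /escort mulrC EFinM.
rewrite ge0_integralZl_EFin//; first last.
- by rewrite invr_ge0 ltW.
- exact/measurable_EFinP.
- by move=> x _; rewrite lee_fin.
by rewrite -Mq_integral Mq_fineK -EFinM mulVf ?gt_eqF.
Qed.

Lemma escort_eq0 x : p1 x = 0%R -> escort mu q p1 p0 x = 0%R.
Proof. by rewrite /escort /tilt => ->; rewrite powR0 ?mul0r// gt_eqF. Qed.

(* [p log (p / p1)], with its term [p log (p / pq) / q] replaced by the lower
   bound [(p - pq) / q], where [pq] is the escort density. *)
Definition KL_minorant (p : X -> R) (x : X) : R :=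
  ((1 - q^-1) * (p x * ln (p x / p0 x)) - ln m / q * p x +
   q^-1 * (p x - escort mu q p1 p0 x))%R.

Lemma measurable_KL_minorant p : nonneg_density p ->
  measurable_fun [set: X] (KL_minorant p).
Proof.
move=> np; have [mp _] := np; have [[me _] _] := escort_prob_density.
apply: measurable_funD; first apply: measurable_funB; apply: measurable_funM => //.
- exact: measurable_KL_integrand.
- exact: measurable_funB.
Qed.

Lemma integral_KL_minorant p (eta : R) : prob_density mu p ->
  KL mu p p0 = eta%:E ->
  \int[mu]_x (KL_minorant p x)%:E = ((1 - q^-1) * eta - ln m / q)%:E.
Proof.
move=> [np ip] kp; have [ne ie] := escort_prob_density.
(* A finite integral forces integrability, because an integral that does not converge absolutely has
   an infinite value. *)
have iD (f : X -> R) r : measurable_fun [set: X] f ->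
    \int[mu]_x (f x)%:E = r%:E -> mu.-integrable [set: X] (EFin \o f).
  move=> mf ifr; apply/integrableP; split; first exact/measurable_EFinP.
  by rewrite integral_fin_num_abs// ifr.
have ac : abs_cont mu p p0 by apply: abs_cont_KL_neqy; rewrite ?kp.
rewrite KL_abs_cont// in kp.
have Ik := iD _ _ (measurable_KL_integrand _ _ _ _ _ np hp0) kp.
have Ip := iD _ _ np.1 ip; have Ie := iD _ _ ne.1 ie.
rewrite (_ : \int[mu]_x (KL_minorant p x)%:E =
  \int[mu]_x ((1 - q^-1)%:E * (p x * ln (p x / p0 x))%:E -
    (ln m / q)%:E * (p x)%:E +
    (q^-1)%:E * ((p x)%:E - (escort mu q p1 p0 x)%:E)))//.
rewrite integralD//; last first.
- by apply: integrableZl => //; exact: integrableB.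
- by apply: integrableB => //; exact: integrableZl.
rewrite integralB//; [|exact: integrableZl..].
rewrite !integralZl//; last exact: integrableB.
by rewrite integralB// kp ip ie subee// mule0 adde0 mule1.
Qed.

Lemma KL_minorant_le p x : (0 <= p x)%R -> (0 <= p1 x)%R -> (0 <= p0 x)%R ->
  (p0 x = 0%R -> p1 x = 0%R) -> (p1 x = 0%R -> p x = 0%R) ->
  (KL_minorant p x <= p x * ln (p x / p1 x))%R.
Proof.
move=> px p1x p0x h01 h1.
have [_ e0] := escort_prob_density.1.
have q0 : (0 <= q^-1)%R by rewrite invr_ge0 ltW.
(* Where [p x = 0] the minorant is [- escort / q <= 0]; elsewhere [p1 x] and [p0 x] are positive and
   the decomposition applies. *)
move: px; rewrite le_eqVlt /KL_minorant => /predU1P[<-|px].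
  by rewrite !(mul0r, mulr0) subr0 add0r sub0r mulrN oppr_le0 mulr_ge0.
have {}p1x : (0 < p1 x)%R.
  by rewrite lt_neqAle p1x andbT eq_sym; apply/eqP => /h1 px0; rewrite px0 ltxx in px.
have {}p0x : (0 < p0 x)%R.
  by rewrite lt_neqAle p0x andbT eq_sym; apply/eqP => /h01 E; rewrite E ltxx in p1x.
have m0 := fine_Mq_gt0.
rewrite [leRHS](mul_ln_div_tilt _ _ _ _ _ _ hq m0 px p1x p0x) lerD2l.
apply: ler_wpM2l => //; apply: le_mul_ln_div => //.
by rewrite /escort divr_gt0// mulr_gt0// powR_gt0.
Qed.

(** For [p] the escort density, the replaced term and its lower bound both vanish. *)
Lemma KL_minorant_escort x : (0 <= p1 x)%R -> (0 <= p0 x)%R ->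
  (p0 x = 0%R -> p1 x = 0%R) ->
  (KL_minorant (escort mu q p1 p0) x =
   escort mu q p1 p0 x * ln (escort mu q p1 p0 x / p1 x))%R.
Proof.
move=> p1x p0x h01.
move: p1x; rewrite le_eqVlt => /predU1P[/esym/escort_eq0|p1x].
  by rewrite /KL_minorant => ->; rewrite !(mul0r, mulr0) !subr0 mulr0 addr0.
have {}p0x : (0 < p0 x)%R.
  by rewrite lt_neqAle p0x andbT eq_sym; apply/eqP => /h01 E; rewrite E ltxx in p1x.
have m0 := fine_Mq_gt0.
have ex : (0 < escort mu q p1 p0 x)%R by rewrite /escort divr_gt0// mulr_gt0// powR_gt0.
rewrite [RHS](mul_ln_div_tilt _ _ _ _ _ _ hq m0 ex p1x p0x) /KL_minorant.
by rewrite subrr -/(tilt q p1 p0 x) -/(escort mu q p1 p0 x) divff ?gt_eqF// ln1 !mulr0.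
Qed.

End escort_facts.

(** * The constrained minimum and its Rényi form *)

Theorem corollary7 (d : measure_display) (X : measurableType d) (R : realType)
    (mu : {measure set X -> \bar R}) (p1 p0 : X -> R) (q eta : R)
    (hp1 : prob_density mu p1) (hp0 : nonneg_density p0)
    (hac : abs_cont mu p1 p0)
    (hq : (0 < q)%R)
    (hM : Mq mu q p1 p0 < +oo)
    (hE : escort_mean mu q p1 p0 (log_ratio p1 p0) \is a fin_num)
    (heta : KL mu (escort mu q p1 p0) p0 = eta%:E) :
  let pq := escort mu q p1 p0 in
  let C := [set p : X -> R | prob_density mu p /\ KL mu p p0 = eta%:E] in
  [/\ C pq,
      forall p : X -> R, C p -> KL mu pq p1 <= KL mu p p1
    & KL mu pq p1 = (1 - q^-1)%:E * (eta%:E - renyi mu q p1 p0)].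
Proof.
move=> pq C.
have hpq : prob_density mu pq by exact: escort_prob_density.
have [n1 i1] := hp1; have [nq _] := hpq; have [_ p1_ge0] := n1.
have [_ p0_ge0] := hp0; have m0 : (0 < fine (Mq mu q p1 p0))%R by exact: fine_Mq_gt0.
have KLpq : KL mu pq p1 = ((1 - q^-1) * eta - ln (fine (Mq mu q p1 p0)) / q)%:E.
  rewrite KL_abs_cont//; last by apply: aeW => x; exact: escort_eq0.
  rewrite -(integral_KL_minorant _ _ _ mu p1 p0 q hp1 hp0 hac hM pq)//.
  apply: ae_eq_integral => //.
  - by apply/measurable_EFinP; exact: measurable_KL_integrand.
  - by apply/measurable_EFinP; exact: measurable_KL_minorant.
  by apply: filterS (hac) => x h01 _; rewrite KL_minorant_escort.
split => [//|p [hp kp]|]; last first.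
  (* For [q = 1] both sides are 0: [tilt] is [p1], so the normalizing constant is 1. Otherwise
     [(1 - 1/q) / (q - 1) = 1/q]. *)
  rewrite KLpq /renyi; case: eqP => [q1|/eqP q1].
    rewrite q1 invr1 subrr mul0r mul0e sub0r Mq_integral// (_ : tilt _ _ _ = p1).
      by rewrite i1/= ln1 mul0r oppr0.
    by apply/funext => x; rewrite /tilt subrr powRr0 mulr1 powRr1.
  rewrite {2}Mq_fineK// lne_EFin// -EFinM; congr EFin.
  by field; rewrite subr_eq0 q1 gt_eqF.
(* An infinite divergence is a trivial bound; otherwise [p] is absolutely continuous with respect to
   [p1], as the pointwise minorant requires. *)
have [->|kp1] := eqVneq (KL mu p p1) +oo; first exact: leey.
have [np _] := hp; have ac1 : abs_cont mu p p1 by exact: abs_cont_KL_neqy.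
rewrite KLpq (KL_abs_cont _ _ _ mu p p1)//.
rewrite -(integral_KL_minorant _ _ _ mu p1 p0 q hp1 hp0 hac hM p)//.
apply: le_integral_ae.
- by apply/measurable_EFinP; exact: measurable_KL_minorant.
- by apply/measurable_EFinP; exact: measurable_KL_integrand.
have [_ p_ge0] := np.
by apply: filterS2 (hac) ac1 => x h01 h1; rewrite lee_fin KL_minorant_le.
Qed.
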